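(* (Symmetry principle) Let $\mathcal{E}$ be an exact category with enough projectives and enough injectives, let $\mathcal{P}$ be the full subcategory of projective objects and $\mathcal{I}$ the full subcategory of injective objects of $\mathcal{E}$, let $\mathcal{M}$ be a full additive subcategory of $\mathcal{E}$ and let $k\ge 1$. The following two statements are equivalent: (1) $\mathcal{P}\subset \mathrm{cogen}^k_{\mathcal{E}}(\mathcal{M})$, and $\Phi(I)=\mathrm{Hom}_{\mathcal{E}}(-,I)|_{\mathcal{M}}\in \mathrm{mod}_k\text{-}\mathcal{M}$ for every $I\in\mathcal{I}$. (2) $\mathcal{I}\subset \mathrm{gen}_k^{\mathcal{E}}(\mathcal{M})$, and $\Psi(P)=\mathrm{Hom}_{\mathcal{E}}(P,-)|_{\mathcal{M}}\in \mathcal{M}\text{-}\mathrm{mod}_k$ for every $P\in\mathcal{P}$.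
   Context: Exact categories are in the sense of Quillen; a longer sequence in $\mathcal{E}$ is called exact if it is obtained by splicing short exact sequences of the exact structure. For $k\ge 1$ and a full additive subcategory $\mathcal{M}\subset\mathcal{E}$: - $\mathrm{cogen}^k_{\mathcal{E}}(\mathcal{M})$ is the full subcategory of $\mathcal{E}$ of all $X$ for which there is an exact sequence $0\to X\to M_0\to\cdots\to M_k\to Z\to 0$ in $\mathcal{E}$ with $M_i\in\mathcal{M}$ for $0\le i\le k$ such that for every $M\in\mathcal{M}$ the sequence $\mathrm{Hom}_{\mathcal{E}}(M_k,M)\to\cdots\to\mathrm{Hom}_{\mathcal{E}}(M_0,M)\to\mathrm{Hom}_{\mathcal{E}}(X,M)\to 0$ of abelian groups is exact. - $\mathrm{gen}_k^{\mathcal{E}}(\mathcal{M})$ is the full subcategory of $\mathcal{E}$ of all $X$ for which there is an exact sequence $0\to Z\to M_k\to\cdots\to M_0\to X\to 0$ in $\mathcal{E}$ with $M_i\in\mathcal{M}$ for $0\le i\le k$ such that for every $M\in\mathcal{M}$ the sequence $\mathrm{Hom}_{\mathcal{E}}(M,M_k)\to\cdots\to\mathrm{Hom}_{\mathcal{E}}(M,M_0)\to\mathrm{Hom}_{\mathcal{E}}(M,X)\to 0$ of abelian groups is exact. A right $\mathcal{M}$-module is a contravariant additive functor from $\mathcal{M}$ to abelian groups. $\mathrm{mod}_k\text{-}\mathcal{M}$ is the category of right $\mathcal{M}$-modules $F$ admitting a $k$-presentation, i.e. an exact sequence $Q_k\to\cdots\to Q_0\to F\to 0$ with all $Q_i$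 finitely generated projective $\mathcal{M}$-modules (direct summands of representable functors). $\mathcal{M}\text{-}\mathrm{mod}_k:=\mathrm{mod}_k\text{-}\mathcal{M}^{op}$ is the analogous category of covariant additive functors. *)

(* Defs.v *)
From mathcomp Require Import all_boot all_algebra.

Set Implicit Arguments.
Unset Strict Implicit.
Unset Printing Implicit Defensive.

Import GRing.Theory.
Local Open Scope ring_scope.

Reserved Notation "g \oc f" (at level 40, left associativity).

Record preadditive := Preadditive {
  Ob :> Type;
  Hom : Ob -> Ob -> zmodType;
  idm : forall X, Hom X X;
  comp : forall X Y Z, Hom Y Z -> Hom X Y -> Hom X Z;
  compA : forall W X Y Z (h : Hom Y Z) (g : Hom X Y) (f : Hom W X),
    comp h (comp g f) = comp (comp h g) f;
  comp1m : forall X Y (f : Hom X Y), comp (idm Y) f = f;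
  compm1 : forall X Y (f : Hom X Y), comp f (idm X) = f;
  compDl : forall X Y Z (g g' : Hom Y Z) (f : Hom X Y),
    comp (g + g') f = comp g f + comp g' f;
  compDr : forall X Y Z (g : Hom Y Z) (f f' : Hom X Y),
    comp g (f + f') = comp g f + comp g f'
}.

Notation "g \oc f" := (comp g f).
Arguments idm {p} X.

Definition op (C : preadditive) : preadditive :=
  @Preadditive C (fun X Y => Hom Y X) (@idm C) (fun X Y Z g f => f \oc g)
    (fun W X Y Z h g f => esym (compA f g h))
    (fun X Y f => compm1 f) (fun X Y f => comp1m f)
    (fun X Y Z g g' f => compDr f g g') (fun X Y Z g f f' => compDl f f' g).

Definition full_sub (C : preadditive) (M : C -> Prop) : preadditive :=
  @Preadditive {X : C | M X} (fun X Y => Hom (sval X) (sval Y))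
    (fun X => idm (sval X)) (fun X Y Z g f => g \oc f)
    (fun W X Y Z h g f => compA h g f)
    (fun X Y f => comp1m f) (fun X Y f => compm1 f)
    (fun X Y Z g g' f => compDl g g' f) (fun X Y Z g f f' => compDr g f f').

Section Limits.
Variable C : preadditive.

Definition is_zero_object (Z : C) : Prop :=
  forall X : C, (forall f : Hom Z X, f = 0) /\ (forall f : Hom X Z, f = 0).

Definition is_biproduct (X Y B : C) : Prop :=
  exists (i1 : Hom X B) (i2 : Hom Y B) (p1 : Hom B X) (p2 : Hom B Y),
    [/\ p1 \oc i1 = idm X, p2 \oc i2 = idm Y, p1 \oc i2 = 0, p2 \oc i1 = 0
      & i1 \oc p1 + i2 \oc p2 = idm B].

Definition is_additive : Prop :=
  (exists Z : C, is_zero_object Z) /\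
  (forall X Y : C, exists B : C, is_biproduct X Y B).

Definition is_iso (X Y : C) (f : Hom X Y) : Prop :=
  exists g : Hom Y X, g \oc f = idm X /\ f \oc g = idm Y.

Definition is_kernel (X Y Z : C) (i : Hom X Y) (p : Hom Y Z) : Prop :=
  p \oc i = 0 /\
  forall (T : C) (t : Hom T Y), p \oc t = 0 -> exists! u : Hom T X, i \oc u = t.

Definition is_cokernel (X Y Z : C) (i : Hom X Y) (p : Hom Y Z) : Prop :=
  p \oc i = 0 /\
  forall (T : C) (t : Hom Y T), t \oc i = 0 -> exists! u : Hom Z T, u \oc p = t.

Definition is_pushout (X Y X' Y' : C)
    (f : Hom X Y) (g : Hom X X') (f' : Hom X' Y') (g' : Hom Y Y') : Prop :=
  g' \oc f = f' \oc g /\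
  forall (T : C) (u : Hom Y T) (v : Hom X' T), u \oc f = v \oc g ->
    exists! w : Hom Y' T, w \oc g' = u /\ w \oc f' = v.

Definition is_pullback (X Y X' Y' : C)
    (f : Hom X Y) (g : Hom Y' Y) (f' : Hom X' Y') (g' : Hom X' X) : Prop :=
  f \oc g' = g \oc f' /\
  forall (T : C) (u : Hom T X) (v : Hom T Y'), f \oc u = g \oc v ->
    exists! w : Hom T X', g' \oc w = u /\ f' \oc w = v.

End Limits.

(* Quillen exact categories, in the standard axiomatization without Quillen's
   redundant "obscure axiom" (Keller; Buehler, Exact categories, Def. 2.1).
   [exs i p] says that X -i-> Y -p-> Z is a short exact sequence of the exact
   structure. *)
Record exact_category := ExactCategory {
  underlying :> preadditive;
  underlying_additive : is_additive underlying;
  exs : forall X Y Z : underlying, Hom X Y -> Hom Y Z -> Prop;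
  exs_kernel : forall (X Y Z : underlying) (i : Hom X Y) (p : Hom Y Z),
    exs i p -> is_kernel i p;
  exs_cokernel : forall (X Y Z : underlying) (i : Hom X Y) (p : Hom Y Z),
    exs i p -> is_cokernel i p;
  exs_iso : forall (X Y Z X' Y' Z' : underlying)
      (i : Hom X Y) (p : Hom Y Z) (i' : Hom X' Y') (p' : Hom Y' Z')
      (a : Hom X X') (b : Hom Y Y') (c : Hom Z Z'),
    is_iso a -> is_iso b -> is_iso c ->
    b \oc i = i' \oc a -> c \oc p = p' \oc b -> exs i p -> exs i' p';
  inflation := fun (X Y : underlying) (i : Hom X Y) =>
    exists (Z : underlying) (p : Hom Y Z), exs i p;
  deflation := fun (Y Z : underlying) (p : Hom Y Z) =>
    exists (X : underlying) (i : Hom X Y), exs i p;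
  inflation_id : forall X : underlying, inflation (idm X);
  deflation_id : forall X : underlying, deflation (idm X);
  inflation_comp : forall (X Y Z : underlying) (g : Hom Y Z) (f : Hom X Y),
    inflation g -> inflation f -> inflation (g \oc f);
  deflation_comp : forall (X Y Z : underlying) (g : Hom Y Z) (f : Hom X Y),
    deflation g -> deflation f -> deflation (g \oc f);
  inflation_pushout : forall (X Y X' : underlying) (f : Hom X Y) (g : Hom X X'),
    inflation f ->
    exists (Y' : underlying) (f' : Hom X' Y') (g' : Hom Y Y'),
      is_pushout f g f' g' /\ inflation f';
  deflation_pullback : forall (X Y Y' : underlying) (f : Hom X Y) (g : Hom Y' Y),
    deflation f ->
    exists (X' : underlying) (f' : Hom X' Y') (g' : Hom X' X),
      is_pullback f g f' g' /\ deflation f'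
}.

Section ProjectivesInjectives.
Variable E : exact_category.

Definition is_projective (P : E) : Prop :=
  forall (Y Z : E) (p : Hom Y Z), deflation p ->
  forall f : Hom P Z, exists g : Hom P Y, p \oc g = f.

Definition is_injective (I : E) : Prop :=
  forall (X Y : E) (i : Hom X Y), inflation i ->
  forall f : Hom X I, exists g : Hom Y I, g \oc i = f.

Definition enough_projectives : Prop :=
  forall X : E, exists (P : E) (p : Hom P X), is_projective P /\ deflation p.

Definition enough_injectives : Prop :=
  forall X : E, exists (I : E) (i : Hom X I), is_injective I /\ inflation i.

End ProjectivesInjectives.

(* Exactness of G k -> ... -> G 0 -> G' -> 0, with maps d n : G n.+1 -> G n and
   a : G 0 -> G'.  Nothing is required of kernels at G k, and the terms of index
   larger than k are ignored. *)
Definition right_exact (k : nat) (G : nat -> zmodType) (G' : zmodType)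
    (d : forall n, G n.+1 -> G n) (a : G 0%N -> G') : Prop :=
  [/\ forall y : G', exists x : G 0%N, a x = y,
      (0 < k)%N ->
        forall x : G 0%N, a x = 0 <-> exists x' : G 1%N, d 0%N x' = x
    & forall n, (n.+1 < k)%N ->
        forall x : G n.+1, d n x = 0 <-> exists x' : G n.+2, d n.+1 x' = x].

Section CogenGen.
Variable E : exact_category.

(* 0 -> X -x-> A 0 -d 0-> ... -> A k -> Z -> 0 is spliced from the short exact
   sequences X -> A 0 -> K 0 and K n -> A n.+1 -> K n.+1 for n < k, where
   Z = K k with last map e k.  Data beyond these indices is ignored. *)
Definition exact_coresolution (k : nat) (X : E) (A : nat -> E)
    (x : Hom X (A 0%N)) (d : forall n, Hom (A n) (A n.+1)) : Prop :=
  exists (K : nat -> E) (e : forall n, Hom (A n) (K n))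
         (m : forall n, Hom (K n) (A n.+1)),
    exs x (e 0%N) /\
    forall n, (n < k)%N -> d n = m n \oc e n /\ exs (m n) (e n.+1).

(* Dually for 0 -> Z -> A k -> ... -> A 0 -x-> X -> 0, where Z = K k. *)
Definition exact_resolution (k : nat) (X : E) (A : nat -> E)
    (x : Hom (A 0%N) X) (d : forall n, Hom (A n.+1) (A n)) : Prop :=
  exists (K : nat -> E) (m : forall n, Hom (K n) (A n))
         (e : forall n, Hom (A n.+1) (K n)),
    exs (m 0%N) x /\
    forall n, (n < k)%N -> d n = m n \oc e n /\ exs (m n.+1) (e n).

Definition cogen (k : nat) (M : E -> Prop) (X : E) : Prop :=
  exists (A : nat -> E) (x : Hom X (A 0%N)) (d : forall n, Hom (A n) (A n.+1)),
    [/\ exact_coresolution k x d,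
        forall n, (n <= k)%N -> M (A n)
      & forall N : E, M N ->
        @right_exact k (fun n => Hom (A n) N) (Hom X N)
          (fun n f => f \oc d n) (fun f => f \oc x)].

Definition gen (k : nat) (M : E -> Prop) (X : E) : Prop :=
  exists (A : nat -> E) (x : Hom (A 0%N) X) (d : forall n, Hom (A n.+1) (A n)),
    [/\ exact_resolution k x d,
        forall n, (n <= k)%N -> M (A n)
      & forall N : E, M N ->
        @right_exact k (fun n => Hom N (A n)) (Hom N X)
          (fun n f => d n \oc f) (fun f => x \oc f)].

End CogenGen.

Record module (C : preadditive) := Module {
  mob :> C -> zmodType;
  mact : forall X Y : C, Hom X Y -> mob Y -> mob X;
  mactD : forall (X Y : C) (f : Hom X Y), {morph mact f : a b / a + b};
  mact_addf : forall (X Y : C) (f g : Hom X Y) (a : mob Y),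
    mact (f + g) a = mact f a + mact g a;
  mact1 : forall (X : C) (a : mob X), mact (idm X) a = a;
  mact_comp : forall (X Y Z : C) (g : Hom Y Z) (f : Hom X Y) (a : mob Z),
    mact (g \oc f) a = mact f (mact g a)
}.

Record mhom (C : preadditive) (F G : module C) := MHom {
  mfun :> forall X : C, F X -> G X;
  mfunD : forall X : C, {morph @mfun X : a b / a + b};
  mfun_nat : forall (X Y : C) (f : Hom X Y) (a : F Y),
    mfun (mact f a) = mact f (mfun a)
}.

Definition representable (C : preadditive) (X : C) : module C :=
  @Module C (fun Y => Hom Y X) (fun Y Z f a => a \oc f)
    (fun Y Z f a b => compDl a b f) (fun Y Z f g a => compDr a f g)
    (fun Y a => compm1 a) (fun Y Z W g f a => compA a g f).

Definition restrict (C : preadditive) (M : C -> Prop) (F : module C) :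
    module (full_sub M) :=
  @Module (full_sub M) (fun X => F (sval X))
    (fun X Y f a => @mact C F (sval X) (sval Y) f a)
    (fun X Y f => @mactD C F (sval X) (sval Y) f)
    (fun X Y f g a => @mact_addf C F (sval X) (sval Y) f g a)
    (fun X a => @mact1 C F (sval X) a)
    (fun X Y Z g f a => @mact_comp C F (sval X) (sval Y) (sval Z) g f a).

Section Modules.
Variable C : preadditive.

(* G is the direct sum of F and F'. *)
Definition is_direct_sum (F F' G : module C) : Prop :=
  exists (i : mhom F G) (i' : mhom F' G) (p : mhom G F) (p' : mhom G F'),
    forall X : C,
    [/\ forall a : F X, p X (i X a) = a, forall a : F' X, p' X (i' X a) = a,
        forall a : F' X, p X (i' X a) = 0, forall a : F X, p' X (i X a) = 0
      & forall b : G X, i X (p X b) + i' X (p' X b) = b].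

Definition fg_projective (Q : module C) : Prop :=
  exists (X : C) (Q' : module C), is_direct_sum Q Q' (representable X).

(* Exactness of sequences of modules is exactness at every object. *)
Definition in_mod (k : nat) (F : module C) : Prop :=
  exists (Q : nat -> module C) (d : forall n, mhom (Q n.+1) (Q n))
         (a : mhom (Q 0%N) F),
    (forall n, (n <= k)%N -> fg_projective (Q n)) /\
    forall X : C,
      @right_exact k (fun n => Q n X) (F X) (fun n => d n X) (a X).

End Modules.

Definition Phi (C : preadditive) (M : C -> Prop) (X : C) : module (full_sub M) :=
  restrict M (representable X).

(* Covariant functors on the full subcategory M of C are modules over
   M^op, the full subcategory of [op C] on the same objects; Hom(P, -) on C is
   the representable functor of P on [op C] (see [Psi_ob] and [Psi_act]). *)
Definition Psi (C : preadditive) (M : C -> Prop) (P : C) :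
    module (@full_sub (op C) M) :=
  @Phi (op C) M P.

Lemma full_sub_op (C : preadditive) (M : C -> Prop) :
  @full_sub (op C) M = op (full_sub M).
Proof. by []. Qed.

Lemma Psi_ob (C : preadditive) (M : C -> Prop) (P : C) (X : {X : C | M X}) :
  Psi M P X = Hom P (sval X).
Proof. by []. Qed.

Lemma Psi_act (C : preadditive) (M : C -> Prop) (P : C) (X Y : {X : C | M X})
    (f : Hom (sval X) (sval Y)) (a : Hom P (sval X)) :
  @mact _ (Psi M P) Y X f a = f \oc a.
Proof. by []. Qed.

(* Main.v *)
(* Assume (1) and let I be injective.  Completing the projective presentation of
   Hom(-, I)|M to one by representables gives A_k -> ... -> A_0 -> I in E that is
   exact under Hom(N, -) for N in M.  Extending maps along the coresolution
   P -> M_0 -> ... -> M_k of a projective P shows, by induction, that it is also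
   exact under Hom(P, -).  As there are enough projectives, A_0 -> I is then a
   deflation up to adding to A_0 an object of M that receives an inflation from a
   projective, and one continues with its kernel; idempotent completeness is not
   needed.  This puts I in gen_k(M), while the coresolution of P is already a
   presentation of Hom(P, -)|M.  The converse is the same statement in the
   opposite category. *)
From mathcomp Require Import all_boot all_algebra.
Require Import Defs.

Set Implicit Arguments.
Unset Strict Implicit.
Unset Printing Implicit Defensive.

Import GRing.Theory.
Local Open Scope ring_scope.

(** * Composition and universal properties in preadditive categories *)

Section PreadditiveAlgebra.
Variable C : preadditive.

Lemma comp0m (X Y Z : C) (f : Hom X Y) : (0 : Hom Y Z) \oc f = 0.
Proof. by apply: (addrI ((0 : Hom Y Z) \oc f)); rewrite -compDl !addr0. Qed.

Lemma compm0 (X Y Z : C) (g : Hom Y Z) : g \oc (0 : Hom X Y) = 0.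
Proof. by apply: (addrI (g \oc (0 : Hom X Y))); rewrite -compDr !addr0. Qed.

Lemma compNl (X Y Z : C) (g : Hom Y Z) (f : Hom X Y) :
  (- g) \oc f = - (g \oc f).
Proof. by apply: (addrI (g \oc f)); rewrite -compDl !subrr comp0m. Qed.

Lemma compNr (X Y Z : C) (g : Hom Y Z) (f : Hom X Y) :
  g \oc (- f) = - (g \oc f).
Proof. by apply: (addrI (g \oc f)); rewrite -compDr !subrr compm0. Qed.

Lemma compBl (X Y Z : C) (g g' : Hom Y Z) (f : Hom X Y) :
  (g - g') \oc f = g \oc f - g' \oc f.
Proof. by rewrite compDl compNl. Qed.

Lemma compBr (X Y Z : C) (g : Hom Y Z) (f f' : Hom X Y) :
  g \oc (f - f') = g \oc f - g \oc f'.
Proof. by rewrite compDr compNr. Qed.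

Lemma iso_id (X : C) : is_iso (idm X).
Proof. by exists (idm X); rewrite comp1m. Qed.

Lemma kernel_mono (X Y Z : C) (i : Hom X Y) (p : Hom Y Z) :
  is_kernel i p -> forall (T : C) (u v : Hom T X), i \oc u = i \oc v -> u = v.
Proof.
move=> [pi0 ker] T u v iuv; have [|w [_ uniq]] := ker T (i \oc v).
  by rewrite compA pi0 comp0m.
by rewrite -(uniq u iuv) -(uniq v erefl).
Qed.

Lemma cokernel_epi (X Y Z : C) (i : Hom X Y) (p : Hom Y Z) :
  is_cokernel i p -> forall (T : C) (u v : Hom Z T), u \oc p = v \oc p -> u = v.
Proof.
move=> [pi0 coker] T u v upv; have [|w [_ uniq]] := coker T (v \oc p).
  by rewrite -compA pi0 compm0.
by rewrite -(uniq u upv) -(uniq v erefl).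
Qed.

Lemma pushout_ext (X Y X' Y' : C)
    (f : Hom X Y) (g : Hom X X') (f' : Hom X' Y') (g' : Hom Y Y') :
  is_pushout f g f' g' -> forall (T : C) (u v : Hom Y' T),
  u \oc g' = v \oc g' -> u \oc f' = v \oc f' -> u = v.
Proof.
move=> [sq univ] T u v eg ef.
have [|w [_ uniq]] := univ T (v \oc g') (v \oc f').
  by rewrite -!compA sq.
by rewrite -(uniq u (conj eg ef)) -(uniq v (conj erefl erefl)).
Qed.

Lemma biprod_ext (A N B T : C) (i1 : Hom A B) (i2 : Hom N B)
    (p1 : Hom B A) (p2 : Hom B N) (u v : Hom T B) :
  i1 \oc p1 + i2 \oc p2 = idm B ->
  p1 \oc u = p1 \oc v -> p2 \oc u = p2 \oc v -> u = v.
Proof.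
move=> e1 eu1 eu2.
by rewrite -[u]comp1m -[v]comp1m -e1 !compDl -!compA eu1 eu2.
Qed.

End PreadditiveAlgebra.

(** * Pushouts and deflations in an exact category *)

Section ExactCategory.
Variable E : exact_category.

Lemma exs0 (X Y Z : E) (i : Hom X Y) (p : Hom Y Z) : exs i p -> p \oc i = 0.
Proof. by move=> /exs_kernel[]. Qed.

Lemma exs_mono (X Y Z : E) (i : Hom X Y) (p : Hom Y Z) : exs i p ->
  forall (T : E) (u v : Hom T X), i \oc u = i \oc v -> u = v.
Proof. by move=> /exs_kernel/kernel_mono. Qed.

Lemma exs_epi (X Y Z : E) (i : Hom X Y) (p : Hom Y Z) : exs i p ->
  forall (T : E) (u v : Hom Z T), u \oc p = v \oc p -> u = v.
Proof. by move=> /exs_cokernel/cokernel_epi. Qed.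

Lemma exs_factor (X Y Z : E) (i : Hom X Y) (p : Hom Y Z) : exs i p ->
  forall (T : E) (t : Hom T Y), p \oc t = 0 -> exists u, i \oc u = t.
Proof. by move=> /exs_kernel[_ ker] T t /ker[u [eu _]]; exists u. Qed.

Lemma exs_cofactor (X Y Z : E) (i : Hom X Y) (p : Hom Y Z) : exs i p ->
  forall (T : E) (t : Hom Y T), t \oc i = 0 -> exists u, u \oc p = t.
Proof. by move=> /exs_cokernel[_ ker] T t /ker[u [eu _]]; exists u. Qed.

(** The axiom provides one pushout of [i] that is an inflation. Any other is isomorphic to it by
    [phi] and [psi], and both cokernels are identified with [X], so exactness is transported. *)
Lemma exs_pushout (L B X L' B' : E) (i : Hom L B) (p : Hom B X)
    (u : Hom L L') (i' : Hom L' B') (u' : Hom B B') (w : Hom B' X) :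
  exs i p -> is_pushout i u i' u' -> w \oc u' = p -> w \oc i' = 0 -> exs i' w.
Proof.
move=> ip po wu wi.
have [|B2 [i2 [u2 [po2 [Q [q i2q]]]]]] := @inflation_pushout E _ _ _ i u.
  by exists X, p.
have [phi [[phiu phii] _]] := (proj2 po2) _ u' i' (proj1 po).
have [psi [[psiu psii] _]] := (proj2 po) _ u2 i2 (proj1 po2).
have [c cq] : exists c, c \oc q = w \oc phi.
  by apply: (exs_cofactor i2q); rewrite -compA phii.
have [c' c'p] : exists c', c' \oc p = q \oc u2.
  apply: (exs_cofactor ip).
  by rewrite -compA (proj1 po2) compA (exs0 i2q) comp0m.
apply: (exs_iso (iso_id L') _ _ _ cq i2q).
- exists psi; split.
    by apply: (pushout_ext po2); rewrite -compA comp1m ?phiu ?phii.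
  by apply: (pushout_ext po); rewrite -compA comp1m ?psiu ?psii.
- exists c'; split.
    apply: (exs_epi i2q); rewrite comp1m -compA cq.
    apply: (pushout_ext po2); rewrite -!compA ?phiu ?phii ?wu ?wi //.
    by rewrite compm0 (exs0 i2q).
  by apply: (exs_epi ip); rewrite -compA c'p compA cq -compA phiu wu comp1m.
- by rewrite phii compm1.
Qed.

(* A substitute for the fact that [x] is a deflation as soon as [x \oc g] is,
   which needs [E] to be weakly idempotent complete: the missing kernel K of x
   exists after adding N.  With R the kernel of x \oc g and W the pullback of x
   and x \oc g (so that W "is" K + P), the pushout L of W along P -> N "is"
   K + N, and L -> A + N -> X is the pushout of R -> P -> X along R -> L. *)
Lemma stabilized_deflation (A X P N B : E) (x : Hom A X) (g : Hom P A)
    (j : Hom P N) (i1 : Hom A B) (i2 : Hom N B) (p1 : Hom B A) (p2 : Hom B N) :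
  deflation (x \oc g) -> inflation j ->
  p1 \oc i1 = idm A -> p2 \oc i2 = idm N -> p1 \oc i2 = 0 -> p2 \oc i1 = 0 ->
  i1 \oc p1 + i2 \oc p2 = idm B ->
  deflation (x \oc p1).
Proof.
move=> [R [r rp]] infl_j e11 e22 e12 e21 e1.
have [|W [w1 [w2 [pb [S [s sw1]]]]]] :=
  @deflation_pullback E _ _ _ (x \oc g) x; first by exists R, r.
have [sq univ] := pb.
have w_ext T (a b : Hom T W) :
    w1 \oc a = w1 \oc b -> w2 \oc a = w2 \oc b -> a = b.
  move=> ea eb; have [|c [_ uniq]] := univ T (w2 \oc b) (w1 \oc b).
    by rewrite !compA sq.
  by rewrite -(uniq a (conj eb ea)) -(uniq b (conj erefl erefl)).
have [|sg [[sg2 sg1] _]] := univ P (idm P) g; first by rewrite compm1.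
have [|r' [[r2 r1] _]] := univ R r 0; first by rewrite compm0 (exs0 rp).
(* [w1] is a cokernel of [r'], because its given kernel [s] factors through [r']. *)
have coker T (t : Hom W T) : t \oc r' = 0 -> exists u, u \oc w1 = t.
  move=> tr0; apply: (exs_cofactor sw1).
  have [|z rz] := exs_factor rp (t := w2 \oc s).
    by rewrite compA sq -compA (exs0 sw1) compm0.
  suff -> : s = r' \oc z by rewrite compA tr0 comp0m.
  by apply: w_ext; rewrite compA ?r1 ?r2 ?rz ?(exs0 sw1) ?comp0m.
have [L [l [n [poL _]]]] := inflation_pushout sg infl_j.
have [sqL univL] := poL.
(* [g \oc w2 - w1] vanishes on the section [sg] of [w2] and is killed by [x]: it stands for the
   projection of W to the missing kernel. *)
have [|v [[vn vl] _]] :=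
  univL B i2 (i1 \oc (g \oc w2 - w1) + i2 \oc (j \oc w2)).
  by rewrite compDl -!compA compBl -!compA sg1 sg2 !compm1 subrr compm0 add0r.
exists L, v; apply: (exs_pushout (u := l \oc r') (u' := i1 \oc g + i2 \oc j) rp).
- split.
    rewrite compA vl !compDl -!compA compBl -!compA r1 r2.
    by rewrite subr0.
  move=> T a b eab.
  (* [f1] is the component on A of the map to be found; its component on N has to be [b \oc n]. *)
  have [|f1 f1w] := coker T (a \oc w2 - b \oc l).
    by rewrite compBl -!compA r2 eab subrr.
  have f1g : f1 \oc g + (b \oc n) \oc j = a.
    rewrite -{1}sg1 compA f1w compBl -!compA sg2 compm1.
    by rewrite -sqL subrK.
  exists (f1 \oc p1 + (b \oc n) \oc p2); split.
    split.
      rewrite compDr !compDl -!(compA _ p1) -!(compA _ p2).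
      rewrite !(compA p1) !(compA p2) e11 e12 e21 e22 !comp0m !comp1m !compm0.
      by rewrite addr0 add0r.
    apply: (pushout_ext poL).
      rewrite -compA vn compDl -!compA e12 e22 compm1 compm0.
      by rewrite add0r.
    rewrite -compA vl compDr !compDl -!(compA _ p1) -!(compA _ p2).
    rewrite !(compA p1) !(compA p2) e11 e12 e21 e22 !comp0m !comp1m !compm0.
    rewrite addr0 add0r compBr f1w compA (compA (b \oc n)).
    rewrite addrAC -compDl f1g.
    by rewrite opprB addrC subrK.
  move=> h [ha hb].
  have hi2 : h \oc i2 = b \oc n by rewrite -vn compA hb.
  have hi1 : h \oc i1 = f1.
    apply: (exs_epi sw1); rewrite f1w -hb -(compA h v) vl -ha.
    rewrite !(compBr, compDr, compDl) !compA.
    by rewrite opprD addrACA subrr addr0 opprB addrC subrK.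
  by rewrite -[h]compm1 -e1 compDr !compA hi1 hi2.
- rewrite compDr -!compA !(compA p1) e11 e12 comp1m comp0m compm0.
  by rewrite addr0.
- apply: (pushout_ext poL); rewrite comp0m -!compA ?vl ?vn.
    by rewrite e12 compm0.
  rewrite compDr !(compA p1) e11 e12 comp1m comp0m addr0 compBr.
  by rewrite compA -sq subrr.
Qed.

End ExactCategory.

(** * Lifting and extension along approximations by objects of M *)

Section Approximations.
Variables (E : exact_category) (M : E -> Prop).

(* With y = 0 : Hom X X, this says that Hom(N, A) -> Hom(N, X) is onto. *)
Definition lifts (T : E -> Prop) (A X Y : E) (x : Hom A X) (y : Hom X Y) :=
  forall N, T N -> forall t : Hom N X, y \oc t = 0 -> exists s, x \oc s = t.

(* A complex A_k -> ... -> A_1 -> A -x-> X with A_1, ..., A_k in M that becomes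
   exact at A_(k-1), ..., A under Hom(N, -) for N in T. *)
Fixpoint ladder (T : E -> Prop) (k : nat) (A X : E) (x : Hom A X) : Prop :=
  if k is k'.+1 then
    exists (A1 : E) (d : Hom A1 A),
      [/\ M A1, x \oc d = 0, lifts T d x & ladder T k' d]
  else True.

(** A ladder sees its last map only through the maps which that map kills. *)
Lemma ladder_ker (T : E -> Prop) (k : nat) (A X X' : E)
    (x : Hom A X) (x' : Hom A X') :
  (forall (N : E) (t : Hom N A), x \oc t = 0 <-> x' \oc t = 0) ->
  ladder T k x -> ladder T k x'.
Proof.
case: k => //= k xx' [A1 [d [MA1 xd0 dx lad]]].
exists A1, d; split=> //; first by apply/xx'.
by move=> N TN t /xx'; apply: dx.
Qed.

(** These are the objects that end a lifting problem: the terms of a ladder lie in M, and the object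
    being resolved is injective. *)
Definition target (N : E) : Prop := M N \/ is_injective N.

(* A coresolution Y -> A_0 -> ... -> A_n -> C_n of the kind required by cogen;
   exactness under Hom(-, N) is the extension property of each inflation. *)
Fixpoint coapprox (n : nat) (Y : E) : Prop :=
  exists (A C : E) (i : Hom Y A) (e : Hom A C),
    [/\ M A, exs i e,
        forall N, target N -> forall f : Hom Y N, exists g, g \oc i = f
      & if n is n'.+1 then coapprox n' C else True].

Lemma coapproxW (n : nat) (Y : E) : coapprox n.+1 Y -> coapprox n Y.
Proof.
elim: n Y => [|n IHn] Y [A [C [i [e [MA ie ext coC]]]]]; exists A, C, i, e.
  by split.
by split=> //; apply: IHn.
Qed.

Lemma coapprox_le (m n : nat) (Y : E) :
  (m <= n)%N -> coapprox n Y -> coapprox m Y.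
Proof.
move=> /subnK <-; elim: (n - m)%N => [|d IHd] //.
by rewrite addSn => /coapproxW.
Qed.

Lemma lifts_coapprox0 (A X : E) (x : Hom A X) :
  target X -> lifts M x (0 : Hom X X) -> lifts (coapprox 0) x (0 : Hom X X).
Proof.
move=> tX lx Y [N [C [i [e [MN ie ext _]]]]] t _.
have [t' t'i] := ext X tX t.
have [|s xs] := lx N MN t'; first exact: comp0m.
by exists (s \oc i); rewrite compA xs.
Qed.

(* Extend t along Y -> N, with cokernel C; the failure of the extension to be
   killed by x is a map on C, which lifts and can be corrected for. *)
Lemma lifts_coapproxS (n : nat) (B A X Y : E)
    (d : Hom B A) (x : Hom A X) (y : Hom X Y) :
  target A -> y \oc x = 0 -> lifts M d x ->
  lifts (coapprox n) x y -> lifts (coapprox n.+1) d x.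
Proof.
move=> tA yx0 ld lx P [N [C [i [e [MN ie ext coC]]]]] t xt0.
have [t' t'i] := ext A tA t.
have [|r re] := exs_cofactor ie (t := x \oc t').
  by rewrite -compA t'i.
have [|u xu] := lx C coC r.
  by apply: (exs_epi ie); rewrite -compA re compA yx0 !comp0m.
have [|v dv] := ld N MN (t' - u \oc e).
  by rewrite compBr compA xu re subrr.
exists (v \oc i).
by rewrite compA dv compBl t'i -compA (exs0 ie) compm0 subr0.
Qed.

(** Each step along the ladder uses up one more step of the coresolution, hence the length
    [j + k]. *)
Lemma ladder_coapprox (j k : nat) (A X Y : E) (x : Hom A X) (y : Hom X Y) :
  M A -> y \oc x = 0 -> lifts (coapprox j) x y -> ladder M k x ->
  ladder (fun N => M N \/ coapprox (j + k) N) k x.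
Proof.
elim: k j A X Y x y => //= k IHk j A X Y x y MA yx0 lx [A1 [d [MA1 xd0 ld lad]]].
have lcd : lifts (coapprox j.+1) d x.
  by apply: lifts_coapproxS ld lx => //; left.
exists A1, d; split=> //; last first.
  by rewrite addnS -addSn; apply: IHk MA1 xd0 lcd lad.
move=> N [MN|coN]; first exact: ld.
by apply: lcd; apply: coapprox_le coN; rewrite addnS ltnS leq_addr.
Qed.

(** This is [gen] cut into short exact sequences: exactness under Hom(N, -) becomes surjectivity at
    each deflation. *)
Fixpoint resolved (k : nat) (X : E) : Prop :=
  exists (K A : E) (m : Hom K A) (x : Hom A X),
    [/\ M A, exs m x, lifts M x (0 : Hom X X)
      & if k is k'.+1 then resolved k' K else True].

Hypothesis M_biproduct :
  forall A N, M A -> M N -> exists B, M B /\ is_biproduct A N B.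
Hypothesis enough_proj : enough_projectives E.

(** [T] has to contain M, for the approximation property, and the projectives, whose covers of [X]
    lift to [A] and make [stabilized_deflation] applicable. *)
Lemma resolved_ladder (T : E -> Prop) (k : nat) (A X : E) (x : Hom A X) :
  (forall N, M N -> T N) ->
  (forall P, is_projective P -> T P /\ coapprox 0 P) ->
  M A -> lifts T x (0 : Hom X X) -> ladder T k x -> resolved k X.
Proof.
move=> MT TP; elim: k A X x => [|k IHk] A X x MA lx lad.
all: have [P [p [projP deflp]]] := enough_proj X.
all: have [TPP [N [C [j [e [MN je _ _]]]]]] := TP _ projP.
all: have [|g xg] := lx P TPP p; first exact: comp0m.
all: have [B [MB [i1 [i2 [p1 [p2 [e11 e22 e12 e21 e1]]]]]]] := M_biproduct MA MN.
all: have [||K [m mx]] := stabilized_deflation (x := x) (g := g) (j := j)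
       _ _ e11 e22 e12 e21 e1; [by rewrite xg | by exists C, e |].
all: have lx' : lifts M (x \oc p1) (0 : Hom X X) by
  move=> Q MQ t _; have [|s <-] := lx Q (MT Q MQ) t; [exact: comp0m |];
  exists (i1 \oc s); rewrite -!compA (compA p1) e11 comp1m.
  by exists K, B, m, (x \oc p1).
exists K, B, m, (x \oc p1); split=> //.
case: lad => A1 [d [MA1 xd0 ld lad]].
have [B1 [MB1 [j1 [j2 [q1 [q2 [f11 f22 f12 f21 f1]]]]]]] := M_biproduct MA1 MN.
(* The kernel of [x \oc p1] also contains the added N, so the next term A1 is enlarged by N, which
   [z] includes. *)
have [|z mz] := exs_factor mx (t := i1 \oc (d \oc q1) + i2 \oc q2).
  rewrite compDr -!compA !(compA p1) e11 e12 comp1m comp0m compm0 addr0.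
  by rewrite compA xd0 comp0m.
have p1mz : p1 \oc (m \oc z) = d \oc q1.
  by rewrite mz compDr !(compA p1) e11 e12 comp1m comp0m addr0.
have p2mz : p2 \oc (m \oc z) = q2.
  by rewrite mz compDr !(compA p2) e21 e22 comp1m comp0m add0r.
have zt0 S (t : Hom S B1) : z \oc t = 0 <-> d \oc (q1 \oc t) = 0 /\ q2 \oc t = 0.
  split=> [zt0|[dt0 qt0]].
    by rewrite compA -p1mz -p2mz -!compA zt0 !compm0.
  apply: (exs_mono mx); apply: (biprod_ext e1).
    by rewrite !(compA m) (compA p1) p1mz -compA dt0 !compm0.
  by rewrite !(compA m) (compA p2) p2mz qt0 !compm0.
apply: (IHk B1 K z MB1).
  move=> S TS t _.
  have [|s ds] := ld S TS (p1 \oc (m \oc t)).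
    by rewrite !compA (exs0 mx) comp0m.
  exists (j1 \oc s + j2 \oc (p2 \oc (m \oc t))); apply: (exs_mono mx).
  apply: (biprod_ext e1).
    rewrite (compA m z) (compA p1) p1mz -ds compDr -!compA !(compA q1) f11 f12.
    by rewrite comp1m comp0m compm0 addr0.
  rewrite (compA m z) (compA p2) p2mz compDr !(compA q2) f21 f22.
  by rewrite comp1m comp0m add0r.
(* By [zt0], [z] kills only what [d] kills inside A1, so the old ladder continues through the split
   inclusion [j1]. *)
case: k {IHk} lad => //= k [A2 [d2 [MA2 dd0 ld2 lad]]].
exists A2, (j1 \oc d2); split=> //.
- by apply/zt0; rewrite !(compA _ j1) f11 f21 comp1m comp0m.
- move=> S TS t /zt0[dt0 qt0].
  have [s ds] := ld2 S TS _ dt0.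
  exists s; apply: (biprod_ext f1); rewrite -!compA !(compA _ j1) ?f11 ?f21.
    by rewrite comp1m.
  by rewrite comp0m qt0.
apply: ladder_ker lad => S t; split=> [dt0|]; first by rewrite -compA dt0 compm0.
by move=> /(congr1 (comp q1)); rewrite -compA (compA q1) f11 comp1m compm0.
Qed.

End Approximations.

(** * Comparison with the sequences defining gen and cogen *)

Section Resolutions.
Variables (E : exact_category) (M : E -> Prop).

Lemma resolved_families (k : nat) (X : E) : resolved M k X ->
  exists (A K : nat -> E) (x : Hom (A 0%N) X) (m : forall n, Hom (K n) (A n))
    (e : forall n, Hom (A n.+1) (K n)),
    [/\ exs (m 0%N) x, forall n, (n < k)%N -> exs (m n.+1) (e n),
        forall n, (n <= k)%N -> M (A n), lifts M x (0 : Hom X X)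
      & forall n, (n < k)%N -> lifts M (e n) (0 : Hom (K n) (K n))].
Proof.
elim: k X => [|k IHk] X [K0 [A0 [m0 [x0 [MA0 ex0 lx0 resK]]]]].
  (* Only index 0 is constrained here; the zero [e] is a filler. *)
  by exists (fun=> A0), (fun=> K0), x0, (fun=> m0), (fun=> 0).
have [A [K [x [m [e [ex exn MA lx le]]]]]] := IHk _ resK.
pose A' n := if n is n'.+1 then A n' else A0.
pose K' n := if n is n'.+1 then K n' else K0.
pose m' n : Hom (K' n) (A' n) := if n is n'.+1 then m n' else m0.
pose e' n : Hom (A' n.+1) (K' n) := if n is n'.+1 then e n' else x.
by exists A', K', x0, m', e'; split=> //; case=> //.
Qed.

(** Each [m n] is monic and each [e n] is onto under Hom(N, -), so the images of [m n \oc e n] and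
    of [m n] agree, and the latter is the kernel of the preceding map. *)
Lemma resolved_gen (k : nat) (X : E) : resolved M k X -> gen k M X.
Proof.
move=> /resolved_families[A [K [x [m [e [ex exn MA lx le]]]]]].
exists A, x, (fun n => m n \oc e n); split=> //.
  by exists K, m, e; split=> // n nk; split=> //; apply: exn.
have mono n T (u v : Hom T (K n)) : (n <= k)%N -> m n \oc u = m n \oc v -> u = v.
  by case: n u v => [|n] u v nk; apply: exs_mono; [exact: ex | exact: exn].
have exactness n N (t : Hom N (A n)) : M N -> (n < k)%N ->
    (exists u, m n \oc u = t) <-> (exists s, m n \oc e n \oc s = t).
  move=> MN nk; split=> [[u <-]|[s <-]]; last by exists (e n \oc s); rewrite compA.
  have [|s <-] := le n nk N MN u; first exact: comp0m.
  by exists s; rewrite compA.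
move=> N MN; split=> [y|k_gt0 t|n nk t].
- by apply: lx => //; apply: comp0m.
- apply: iff_trans (exactness _ _ t MN k_gt0); split=> [/(exs_factor ex)//|[u <-]].
  by rewrite compA (exs0 ex) comp0m.
apply: iff_trans (exactness _ _ t MN nk); split=> [mt0|[u <-]].
  apply: (exs_factor (exn n (ltnW nk))).
  apply: (mono n); first by do 2 apply: ltnW.
  by rewrite compA mt0 compm0.
by rewrite -compA (compA (e n)) (exs0 (exn n (ltnW nk))) comp0m compm0.
Qed.

Lemma cogen_coapprox (k : nat) (X : E) : cogen k M X -> coapprox M k X.
Proof.
move=> [A [x [d [[K [e [m [ex exn]]]] MA rex]]]].
have epi n T (u v : Hom (K n) T) : (n <= k)%N -> u \oc e n = v \oc e n -> u = v.
  case: n u v => [|n] u v nk; apply: exs_epi; first exact: ex.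
  by have [_ exs_n] := exn n nk; apply: exs_n.
have ext n N : (n < k)%N -> target M N ->
    forall f : Hom (K n) N, exists g, g \oc m n = f.
  move=> nk [MN|injN] f; last first.
    by apply: injN; exists (K n.+1), (e n.+1); have [] := exn n nk.
  have [_ exact0 exactS] := rex N MN.
  (* [f \oc e n] vanishes on the preceding map, so exactness under Hom(-, N) extends it along [d n];
     then the epimorphism [e n] is cancelled. *)
  suff [g gd] : exists g, g \oc d n = f \oc e n.
    exists g; apply: epi; first exact: ltnW.
    by rewrite -gd -compA; have [->] := exn n nk.
  case: n nk f => [|n] nk f.
    by apply/exact0; rewrite // -compA (exs0 ex) compm0.
  have [dn exs_n] := exn n (ltnW nk).
  apply/exactS; first exact: nk.
  by rewrite dn -!compA (compA (e n.+1)) (exs0 exs_n) comp0m compm0.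
have step n j : (n < k)%N ->
    (if j is j'.+1 then coapprox M j' (K n.+1) else True) -> coapprox M j (K n).
  move=> nk coK; have [_ exs_n] := exn n nk.
  have step := And4 (MA n.+1 nk) exs_n (fun N => @ext n N nk) coK.
  by case: j coK step => [|j] coK step; exists (A n.+1), (K n.+1), (m n), (e n.+1).
have coK n j : (n.+1 + j = k)%N -> coapprox M j (K n).
  elim: j n => [|j IHj] n njk; apply: step; rewrite -?njk ?ltnS ?leq_addr //.
  by apply: IHj; rewrite -njk addSnnS.
have extX N : target M N -> forall f : Hom X N, exists g, g \oc x = f.
  case=> [MN|injN] f; last by apply: injN; exists (K 0%N), (e 0%N).
  by have [ontoX _ _] := rex N MN; apply: ontoX.
case: k MA {rex exn epi ext step} coK => [|k] MA coK.
  by exists (A 0%N), (K 0%N), x, (e 0%N); split=> //; apply: MA.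
by exists (A 0%N), (K 0%N), x, (e 0%N); split=> //; [apply: MA | apply: coK].
Qed.

End Resolutions.

(** * Module presentations and retracts of representables *)

Section Presentations.

Definition zero_module (C : preadditive) : module C :=
  @Module C (fun=> 'I_1) (fun _ _ _ a => a) (fun _ _ _ _ _ => erefl)
    (fun _ _ _ _ a => etrans (ord1 _) (esym (ord1 _))) (fun _ _ => erefl)
    (fun _ _ _ _ _ _ => erefl).

Lemma fg_projective_representable (C : preadditive) (X : C) :
  fg_projective (representable X).
Proof.
pose R := representable X.
pose one : mhom R R := @MHom C R R (fun _ a => a)
  (fun _ _ _ => erefl) (fun _ _ _ _ => erefl).
pose zin : mhom (zero_module C) R := @MHom C (zero_module C) R (fun _ _ => 0)
  (fun _ _ _ => esym (addr0 0)) (fun _ _ f _ => esym (comp0m _ f)).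
pose zout : mhom R (zero_module C) := @MHom C R (zero_module C) (fun _ _ => 0)
  (fun _ _ _ => esym (addr0 0)) (fun _ _ _ _ => erefl).
exists X, (zero_module C), one, zin, one, zout => T.
by split=> //= [a|b]; rewrite ?addr0 // [RHS]ord1.
Qed.

(** For A n in M, [Phi M (A n)] is the functor represented by A n on the full subcategory, so the
    sequence is itself a presentation. *)
Lemma in_mod_right_exact (C : preadditive) (M : C -> Prop) (k : nat) (X : C)
    (A : nat -> C) (x : Hom (A 0%N) X) (d : forall n, Hom (A n.+1) (A n)) :
  (forall n, (n <= k)%N -> M (A n)) ->
  (forall N : C, M N ->
     @right_exact k (fun n => Hom N (A n)) (Hom N X)
       (fun n f => d n \oc f) (fun f => x \oc f)) ->
  in_mod k (Phi M X).
Proof.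
move=> MA rex.
pose post (Y Z : C) (f : Hom Y Z) : mhom (Phi M Y) (Phi M Z) :=
  @MHom (full_sub M) (Phi M Y) (Phi M Z) (fun N t => f \oc t)
    (fun N => compDr f) (fun N N' t s => compA f s t).
exists (fun n => Phi M (A n)), (fun n => post _ _ (d n)), (post _ _ x).
split=> [n nk|[N MN]]; last exact: rex.
exact: (@fg_projective_representable (full_sub M) (exist _ (A n) (MA n nk))).
Qed.

(* Hom(-, X) = Q + Q' gives Q as a retract of Hom(-, X), with structure maps
   p and i; they are spelled out in the ambient category. *)
Record retract (C : preadditive) (M : C -> Prop) (Q : module (full_sub M))
    (X : C)
    (p : forall T : full_sub M, Hom (sval T) X -> Q T)
    (i : forall T : full_sub M, Q T -> Hom (sval T) X) : Prop := Retract {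
  retract0 : forall T, p T 0 = 0;
  retractB : forall T, {morph p T : s t / s - t};
  retract_nat : forall (T S : full_sub M) (f : Hom (sval S) (sval T)) t,
    p S (t \oc f) = mact (f : Hom S T) (p T t);
  section0 : forall T, i T 0 = 0;
  section_nat : forall (T S : full_sub M) (f : Hom (sval S) (sval T)) q,
    i S (mact (f : Hom S T) q) = i T q \oc f;
  sectionK : forall T, cancel (i T) (p T)
}.

Lemma mhom0 (C : preadditive) (F G : module C) (f : mhom F G) (X : C) :
  f X 0 = 0.
Proof. by apply: (addrI (f X 0)); rewrite -mfunD !addr0. Qed.

Lemma mhomB (C : preadditive) (F G : module C) (f : mhom F G) (X : C) :
  {morph f X : a b / a - b}.
Proof. by move=> a b; apply: (addIr (f X b)); rewrite -mfunD !subrK. Qed.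

Lemma fg_projective_retract (C : preadditive) (M : C -> Prop)
    (Q : module (full_sub M)) :
  fg_projective Q -> exists (X : C) p i, M X /\ @retract C M Q X p i.
Proof.
move=> [[X MX] [Q' [i [i' [p [p' sum]]]]]].
exists X, (fun T => p T), (fun T => i T); split=> //.
split=> [T|T|T S f t|T|T S f q|T q].
- exact (mhom0 p T).
- exact (@mhomB _ _ _ p T).
- exact (@mfun_nat _ _ _ p _ _ f t).
- exact (mhom0 i T).
- exact (@mfun_nat _ _ _ i _ _ f q).
by have [-> _ _ _ _] := sum T.
Qed.

End Presentations.

(** * From presentations of Hom(-, I) to resolutions of I *)

Section Symmetry.
Variables (E : exact_category) (M : E -> Prop) (k : nat).
Hypothesis M_biproduct :
  forall A N, M A -> M N -> exists B, M B /\ is_biproduct A N B.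

Section Presentation.
Variables (Q : nat -> module (full_sub M)).
Variables (d : forall n, mhom (Q n.+1) (Q n)).
Arguments d : clear implicits.
Hypothesis fgQ : forall n, (n <= k)%N -> fg_projective (Q n).
Hypothesis exactQ : forall n T (q : Q n.+1 T), (n.+1 < k)%N ->
  d n T q = 0 <-> exists q', d n.+1 T q' = q.

(* Invariant: Hom(-, Y) = Q n + Q', and c projects Q' onto the part of it that D
   kills, D being injective on a complement of that part; cyc is the kernel of
   the map out of Q n.  The next term is Y + X with Q n.+1 a summand of
   Hom(-, X), mapped to Y by d n on Q n.+1 and by c on Y; hence the next c is
   (1 - c) + (1 - i' p'). *)
Lemma presentation_ladder (j n : nat) (Y Z : E) (D : Hom Y Z) (c : Hom Y Y)
    p i (cyc : forall T, Q n T -> Prop) :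
  (n + j = k)%N -> M Y -> @retract E M (Q n) Y p i ->
  c \oc c = c -> D \oc c = 0 ->
  (forall T q, c \oc i T q = 0) ->
  (forall T t, D \oc t = 0 -> cyc T (p T t) /\ t = i T (p T t) + c \oc t) ->
  (forall T q, cyc T q -> D \oc i T q = 0) ->
  (forall T q, (n < k)%N -> cyc T q <-> exists q', d n T q' = q) ->
  ladder M M j D.
Proof.
elim: j n Y Z D c p i cyc => //= j IHj n Y Z D c p i cyc njk MY retr cc Dc ci
  Dker Dcyc cycE.
have nk : (n < k)%N by rewrite -njk -addSnnS leq_addr.
have [X [p' [i' [MX retr']]]] := fg_projective_retract (fgQ nk).
have [B [MB [in1 [in2 [pr1 [pr2 [e11 e22 e12 e21 e1]]]]]]] := M_biproduct MY MX.
pose tB : full_sub M := exist _ B MB.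
pose D' := i tB (d n tB (p' tB pr2)) + c \oc pr1.
pose c' := in1 \oc (pr1 - c \oc pr1) + in2 \oc (pr2 - i' tB (p' tB pr2)).
have D'E (T : full_sub M) (t : Hom (sval T) B) :
    D' \oc t = i T (d n T (p' T (pr2 \oc t))) + c \oc (pr1 \oc t).
  by rewrite compDl -compA (retract_nat retr' (T := tB)) mfun_nat (section_nat retr).
have c'E (T : full_sub M) (t : Hom (sval T) B) :
    c' \oc t = in1 \oc (pr1 \oc t - c \oc (pr1 \oc t))
             + in2 \oc (pr2 \oc t - i' T (p' T (pr2 \oc t))).
  rewrite compDl -!compA !compBl -!compA.
  by rewrite (retract_nat retr' (T := tB)) (section_nat retr').
have pr1c' : pr1 \oc c' = pr1 - c \oc pr1.
  by rewrite compDr !compA e11 e12 comp1m comp0m addr0.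
have pr2c' : pr2 \oc c' = pr2 - i' tB (p' tB pr2).
  by rewrite compDr !compA e21 e22 comp1m comp0m add0r.
have p'c' : p' tB (pr2 \oc c') = 0.
  by rewrite pr2c' (retractB retr') (sectionK retr') subrr.
have c0 : c \oc (pr1 \oc c') = 0.
  by rewrite pr1c' compBr compA cc subrr.
have pr1in T (u : Hom T X) : pr1 \oc (in2 \oc u) = 0.
  by rewrite compA e12 comp0m.
have pr2in T (u : Hom T X) : pr2 \oc (in2 \oc u) = u.
  by rewrite compA e22 comp1m.
have DD' : D \oc D' = 0.
  rewrite compDr compA Dc comp0m addr0 Dcyc //.
  by apply/cycE => //; eexists.
exists B, D'; split=> //.
  move=> T MT t Dt0; pose tT : full_sub M := exist _ T MT.
  have [cyct tE] := Dker tT t Dt0.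
  have [q dq] := (proj1 (cycE tT _ nk)) cyct.
  (* [D'] sends the first summand to [c \oc t] and the second to the image of [d n T q], which add
     up to [t]. *)
  pose s := in1 \oc t + in2 \oc i' tT q.
  have pr1s : pr1 \oc s = t.
    by rewrite compDr !compA e11 e12 comp1m comp0m addr0.
  have pr2s : pr2 \oc s = i' tT q.
    by rewrite compDr !compA e21 e22 comp1m comp0m add0r.
  by exists s; rewrite (D'E tT) pr1s pr2s (sectionK retr') dq -tE.
apply: (IHj n.+1 B Y D' c' (fun T t => p' T (pr2 \oc t))
  (fun T q => in2 \oc i' T q) (fun T q => d n T q = 0)) => //.
- by rewrite addSnnS.
- split=> [T|T s t|T S f t|T|T S f q|T q].
  + by rewrite compm0 (retract0 retr').
  + by rewrite compBr (retractB retr').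
  + by rewrite compA (retract_nat retr').
  + by rewrite (section0 retr') compm0.
  + by rewrite (section_nat retr') compA.
  + by rewrite compA e22 comp1m (sectionK retr').
- rewrite (c'E tB) c0 p'c' (section0 retr') !subr0 !compA -compDl e1.
  by rewrite comp1m.
- by rewrite (D'E tB) p'c' mhom0 (section0 retr) c0 addr0.
- move=> T q; rewrite c'E pr1in pr2in compm0 subr0.
  by rewrite (sectionK retr') subrr !compm0 addr0.
- move=> T t; rewrite D'E => Dt0.
  (* As [c] is idempotent and kills the image of [i], composing with it separates the two summands
     of [D' \oc t]. *)
  have ct0 : c \oc (pr1 \oc t) = 0.
    have := congr1 (comp c) Dt0.
    by rewrite compDr ci add0r compA cc compm0.
  split.
    move: Dt0; rewrite ct0 addr0 => /(congr1 (p T)).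
    by rewrite (sectionK retr) (retract0 retr).
  rewrite c'E ct0 subr0 addrCA -compDr addrCA subrr addr0 !compA -compDl e1.
  by rewrite comp1m.
- move=> T q dq0; rewrite D'E pr1in pr2in compm0 addr0.
  by rewrite (sectionK retr') dq0 (section0 retr).
by move=> T q n1k; apply: exactQ.
Qed.

End Presentation.

Lemma in_mod_ladder (X : E) : in_mod k (Phi M X) ->
  exists (A : E) (x : Hom A X),
    [/\ M A, lifts M x (0 : Hom X X) & ladder M M k x].
Proof.
move=> [Q [d [a [fgQ rex]]]].
have [A [p [i [MA retr]]]] := fg_projective_retract (fgQ 0%N (leq0n k)).
pose tA : full_sub M := exist _ A MA.
pose x : Hom A X := a tA (p tA (idm A)).
have xE (T : full_sub M) (t : Hom (sval T) A) : x \oc t = a T (p T t).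
  rewrite -[t in RHS]comp1m (retract_nat retr (T := tA)).
  by rewrite mfun_nat.
exists A, x; split=> //.
  move=> T MT t _; pose tT : full_sub M := exist _ T MT.
  have [ontoX _ _] := rex tT; have [q aq] := ontoX t.
  by exists (i tT q); rewrite (xE tT) (sectionK retr) aq.
(* By Yoneda [x] is [a] after the projection to Q 0, so it kills the whole complement: the first [c]
   is [1 - i p]. *)
pose c := idm A - i tA (p tA (idm A)).
have cE (T : full_sub M) (t : Hom (sval T) A) : c \oc t = t - i T (p T t).
  rewrite compBl comp1m -(section_nat retr (T := tA)) -(retract_nat retr (T := tA)).
  by rewrite comp1m.
apply: (@presentation_ladder Q d fgQ _ k 0%N A X x c p i
  (fun T q => a T q = 0)) => //.
- by move=> n T q nk; have [_ _ exactS] := rex T; apply: exactS.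
- rewrite (cE tA) {2}/c (retractB retr) (sectionK retr) subrr.
  by rewrite (section0 retr) subr0.
- by rewrite (xE tA) /c (retractB retr) (sectionK retr) subrr mhom0.
- by move=> T q; rewrite cE (sectionK retr) subrr.
- by move=> T t xt0; rewrite cE addrC subrK -xE.
- by move=> T q aq0; rewrite xE (sectionK retr).
by move=> T q nk; have [_ exact0 _] := rex T; apply: exact0.
Qed.

Hypothesis enough_proj : enough_projectives E.

Lemma cogen_in_mod_gen :
  (forall P : E, is_projective P -> cogen k M P) ->
  forall I : E, is_injective I -> in_mod k (Phi M I) -> gen k M I.
Proof.
move=> cogenP I injI /in_mod_ladder[A [x [MA lx lad]]].
have coP P : is_projective P -> coapprox M k P.
  by move=> projP; apply/cogen_coapprox/cogenP.
have lx0 : lifts (coapprox M 0) x (0 : Hom I I).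
  by apply: lifts_coapprox0 => //; right.
apply: resolved_gen.
apply: (@resolved_ladder E M _ _ (fun N => M N \/ coapprox M k N) k A I x) => //.
- by move=> N; left.
- move=> P projP; split; first by right; apply: coP.
  exact: coapprox_le (coP P projP).
- move=> N [MN|coN]; first exact: lx.
  by apply: lx0; apply: coapprox_le coN.
exact: ladder_coapprox (comp0m _ _) lx0 lad.
Qed.

End Symmetry.

(** * The opposite exact category *)

Section Duality.

Lemma biproduct_op (C : preadditive) (X Y B : C) :
  is_biproduct X Y B -> @is_biproduct (op C) X Y B.
Proof.
by move=> [i1 [i2 [p1 [p2 [e11 e22 e12 e21 e1]]]]]; exists p1, p2, i1, i2.
Qed.

Lemma additive_op (C : preadditive) : is_additive C -> is_additive (op C).
Proof.
move=> [[Z Z0] biprod]; split.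
  by exists Z => X; have [] := Z0 X.
by move=> X Y; have [B XYB] := biprod X Y; exists B; apply: biproduct_op.
Qed.

Lemma iso_op (C : preadditive) (X Y : C) (f : Hom X Y) :
  @is_iso (op C) Y X f -> exists g : Hom Y X,
    [/\ g \oc f = idm X, f \oc g = idm Y & @is_iso C Y X g].
Proof. by move=> [g [fg gf]]; exists g; split=> //; exists f. Qed.

(** Isomorphisms in the opposite category run backwards in E, so [exs_iso] is applied to their
    inverses. *)
Lemma exs_iso_op (E : exact_category) (X Y Z X' Y' Z' : E)
    (i : Hom Y X) (p : Hom Z Y) (i' : Hom Y' X') (p' : Hom Z' Y')
    (a : Hom X' X) (b : Hom Y' Y) (c : Hom Z' Z) :
  @is_iso (op E) X X' a -> @is_iso (op E) Y Y' b -> @is_iso (op E) Z Z' c ->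
  i \oc b = a \oc i' -> p \oc c = b \oc p' -> exs p i -> exs p' i'.
Proof.
move=> /iso_op[a' [a'a aa' isoa]] /iso_op[b' [b'b bb' isob]].
move=> /iso_op[c' [c'c cc' isoc]] bi cp.
apply: (exs_iso isoc isob isoa).
  have <- : b' \oc (b \oc p' \oc c') = p' \oc c' by rewrite !compA b'b comp1m.
  by rewrite -cp -compA cc' compm1.
have <- : a' \oc (a \oc i' \oc b') = i' \oc b' by rewrite !compA a'a comp1m.
by rewrite -bi -compA bb' compm1.
Qed.

Definition op_exact (E : exact_category) : exact_category :=
  @ExactCategory (op E) (additive_op (underlying_additive E))
    (fun X Y Z i p => @exs E Z Y X p i)
    (fun X Y Z i p ip => exs_cokernel ip)
    (fun X Y Z i p ip => exs_kernel ip)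
    (@exs_iso_op E)
    (fun X => deflation_id X) (fun X => inflation_id X)
    (fun X Y Z g f gi fi => deflation_comp fi gi)
    (fun X Y Z g f gi fi => inflation_comp fi gi)
    (fun X Y X' f g fi => deflation_pullback g fi)
    (fun X Y Y' f g fi => inflation_pushout g fi).

Lemma projective_op (E : exact_category) (I : E) :
  is_injective I -> @is_projective (op_exact E) I.
Proof. by move=> injI Y Z p; apply: injI. Qed.

Lemma injective_op (E : exact_category) (P : E) :
  is_projective P -> @is_injective (op_exact E) P.
Proof. by move=> projP X Y i; apply: projP. Qed.

Lemma projective_of_op (E : exact_category) (I : E) :
  @is_projective (op_exact E) I -> is_injective I.
Proof. by move=> projI X Y i; apply: (projI Y X i). Qed.

Lemma enough_projectives_op (E : exact_category) :
  enough_injectives E -> enough_projectives (op_exact E).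
Proof.
move=> enough_inj X; have [I [i [injI infl_i]]] := enough_inj X.
by exists I, i; split=> //; apply: projective_op.
Qed.

End Duality.

Theorem theorem1p2 (E : exact_category)
    (enough_proj : enough_projectives E) (enough_inj : enough_injectives E)
    (M : E -> Prop) (M_additive : is_additive (full_sub M))
    (k : nat) (k_ge1 : (1 <= k)%N) :
  ((forall P : E, is_projective P -> cogen k M P) /\
   (forall I : E, is_injective I -> in_mod k (Phi M I)))
  <->
  ((forall I : E, is_injective I -> gen k M I) /\
   (forall P : E, is_projective P -> in_mod k (Psi M P))).
Proof.
have M_biproduct A N : M A -> M N -> exists B, M B /\ is_biproduct A N B.
  move=> MA MN; have [_ biprod] := M_additive.
  by have [[B MB] sum] := biprod (exist _ A MA) (exist _ N MN); exists B.
split=> [[cogenP modI]|[genI modP]]; split=> [X XI|X XP].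
- by apply: cogen_in_mod_gen (modI X XI).
- have [A [x [d [_ MA rex]]]] := cogenP X XP.
  exact: (@in_mod_right_exact (op E) M k X A x d MA rex).
- have M_biproduct_op A N :
      M A -> M N -> exists B, M B /\ @is_biproduct (op E) A N B.
    move=> MA MN; have [B [MB /biproduct_op sum]] := M_biproduct A N MA MN.
    by exists B.
  (* In the opposite category [gen] and [cogen] trade places and [Psi] is [Phi], all by
     conversion. *)
  exact (@cogen_in_mod_gen (op_exact E) M k M_biproduct_op
    (enough_projectives_op enough_inj)
    (fun I projI => genI I (projective_of_op projI)) X (injective_op XI) (modP X XI)).
have [A [x [d [_ MA rex]]]] := genI X XP.
exact: (in_mod_right_exact MA rex).
Qed.
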